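(* Let $(H,\mu)$ be a commutative Hilbertian Frobenius semigroup. The following assertions are equivalent: (1) $(H,\mu)$ is semisimple; (2) $(H,\mu)$ is faithful, that is, $\ker M=(0)$; (3) $\mu$ has a dense range; (4) $\mu^{\dagger}$ is one-to-one; (5) $\mu\circ\mu^{\dagger}$ is one-to-one. In particular, any commutative special Hilbertian Frobenius semigroup is semisimple.
   Context: All Hilbert spaces are complex; $\hat{\otimes}_2$ is the Hilbert space tensor product; $f^{\dagger}$ is the Hilbert adjoint of a bounded linear map $f$. A Hilbertian algebra (or Hilbertian semigroup) is a pair $(H,\mu)$ with $H$ a Hilbert space and $\mu\colon H\hat{\otimes}_2H\to H$ a bounded linear map which is associative and commutative (no unit is assumed); write $xy:=\mu(x\otimes y)$. With $\alpha\colon (H\hat{\otimes}_2H)\hat{\otimes}_2H\to H\hat{\otimes}_2(H\hat{\otimes}_2H)$ the canonical unitary, $(H,\mu)$ is a (commutative) Hilbertian Frobenius semigroup when moreover $(\mu\hat{\otimes}_2 id)\circ\alpha^{-1}\circ(id\hat{\otimes}_2\mu^{\dagger})=\mu^{\dagger}\circ\mu=(id\hat{\otimes}_2\mu)\circ\alpha\circ(\mu^{\dagger}\hat{\otimes}_2 id)$. It is special when $\mu\circ\mu^{\dagger}=id_H$. The map $M\colon H\to\mathcal{B}(H)$, $u\mapsto M_u$, $M_u(v):=uv$, is the regular representation ($\mathcal{B}(H)$ is the space of bounded linear operators on $H$). $(H,\mu)$ is semisimple when its Jacobson radical $J(H,\mu)$ is $(0)$, where $J(H,\mu)$ is the Jacobson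 radical of the commutative Banach algebra $H$ with product $(x,y)\mapsto xy$ (and an equivalent submultiplicative norm), i.e. the intersection of its maximal modular ideals, equivalently of the kernels of its non-zero algebra maps to $\mathbb{C}$ (so $J(H,\mu)=H$ if there are none). *)

(* Defs.v *)
From HB Require Import structures.
From mathcomp Require Import all_boot all_order all_algebra sesquilinear.
From mathcomp Require Import complex ring lra.
From mathcomp Require Import boolp classical_sets functions filter reals.
From mathcomp Require Import topology normedtype.

Set Implicit Arguments.
Unset Strict Implicit.
Unset Printing Implicit Defensive.

Import Order.TTheory GRing.Theory Num.Theory.
Import numFieldNormedType.Exports.
Local Open Scope classical_set_scope.
Local Open Scope complex_scope.
Local Open Scope ring_scope.

(* A complex Hilbert space is a Banach space over R[i], for R any model of the
   real numbers, whose norm comes from an inner product; the inner product is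
   linear in its first argument and antilinear in the second one. *)
HB.mixin Record isHilbert (R : realType) H & CompleteNormedModule R[i] H := {
  inner : {dot H for @Num.conj R[i]};
  innerE : forall x : H, inner x x = `|x| ^+ 2
}.

#[short(type="hilbertType")]
HB.structure Definition Hilbert (R : realType) :=
  {H of CompleteNormedModule R[i] H & isHilbert R H}.

(* For linear maps between normed spaces, continuity is boundedness:
   see linear_bounded_continuous and bounded_le below. *)
HB.structure Definition BoundedLinear (R : realType)
    (H K : normedModType R[i]) :=
  {f of @GRing.Linear R[i] H K *:%R f & isContinuous H K f}.

Notation "{ 'bounded' H -> K }" := (@BoundedLinear.type _ H K)
  (at level 0, H at level 98, K at level 99,
   format "{ 'bounded'  H  ->  K }") : type_scope.


Section BoundedLinearInstances.
Variables (R : realType) (H K L : normedModType R[i]).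
Variables (f : {bounded H -> K}) (g : {bounded K -> L}).

HB.instance Definition _ := GRing.Linear.on (@idfun H).
HB.instance Definition _ := GRing.Linear.on (g \o f).

End BoundedLinearInstances.

Section InnerTheory.
Variables (R : realType) (H : hilbertType R).
Implicit Types x y z : H.

Lemma innerC x y : inner x y = (inner y x)^*.
Proof. by rewrite hermC expr0 mul1r. Qed.

Lemma inner_CS x y : `|inner x y| <= `|x| * `|y|.
Proof.
have [->|y0] := eqVneq y 0; first by rewrite linear0r !normr0 mulr0.
have ny : 0 < `|y| by rewrite normr_gt0.
rewrite -(@ler_pXn2r _ 2) ?nnegrE ?mulr_ge0//.
pose a := inner x y / inner y y.
have yy0 : inner y y != 0 by rewrite innerE expf_neq0// gt_eqF.
have : 0 <= inner (x - a *: y) (x - a *: y) by rewrite innerE exprn_ge0.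
rewrite linearBl !linearBr !linearZl_LR !linearZr_LR /=.
have -> : a * (a^* * inner y y) = a * inner y x.
  rewrite [inner y x]innerC /a rmorphM/= fmorphV/= -(innerC y y).
  by rewrite mulfVK.
rewrite opprB subrr addr0 [a^* * _](_ : _ = `|inner x y| ^+ 2 / `|y| ^+ 2).
  by rewrite subr_ge0 ler_pdivrMr ?exprn_gt0// innerE exprMn.
by rewrite /a rmorphM/= fmorphV/= -(innerC y y) innerE mulrAC mulrC normCKC mulrC.
Qed.

Lemma innerDl x y z : inner (x + y) z = inner x z + inner y z.
Proof. exact: linearDl. Qed.

Lemma innerDr x y z : inner x (y + z) = inner x y + inner x z.
Proof. exact: linearDr. Qed.

Lemma innerBl x y z : inner (x - y) z = inner x z - inner y z.
Proof. exact: linearBl. Qed.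

Lemma innerBr x y z : inner x (y - z) = inner x y - inner x z.
Proof. exact: linearBr. Qed.

Lemma innerZl a x y : inner (a *: x) y = a * inner x y.
Proof. exact: linearZl_LR. Qed.

Lemma innerZr a x y : inner x (a *: y) = a^* * inner x y.
Proof. exact: linearZr_LR. Qed.

Lemma inner_suml I r (P : pred I) (E : I -> H) y :
  inner (\sum_(i <- r | P i) E i) y = \sum_(i <- r | P i) inner (E i) y.
Proof. exact: linear_sumlz. Qed.

Lemma inner_sumr I r (P : pred I) (E : I -> H) x :
  inner x (\sum_(i <- r | P i) E i) = \sum_(i <- r | P i) inner x (E i).
Proof. exact: linear_sumr. Qed.

Lemma inner_inj y z : (forall x, inner x y = inner x z) -> y = z.
Proof.
move=> yz; apply/eqP; rewrite -subr_eq0 -normr_eq0 -sqrf_eq0 -innerE.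
by rewrite innerBr yz subrr.
Qed.

Lemma parallelogram x y :
  `|x + y| ^+ 2 + `|x - y| ^+ 2 = 2 * `|x| ^+ 2 + 2 * `|y| ^+ 2.
Proof.
rewrite -!innerE innerBl !innerBr innerDl !innerDr; ring.
Qed.

End InnerTheory.

Section Bounded.
Variable R : realType.

Lemma bounded_le (H K : normedModType R[i]) (f : {bounded H -> K}) :
  exists2 C, 0 < C & forall x, `|f x| <= C * `|x|.
Proof.
have /linear_bounded_continuous/linear_boundedP := @cts_fun _ _ f.
by case/pinfty_ex_gt0 => C C0 fC; exists C.
Qed.

Lemma ex_bounded (H K : normedModType R[i]) (f : H -> K) C :
  linear f -> 0 <= C -> (forall x, `|f x| <= C * `|x|) ->
  exists h : {bounded H -> K}, h =1 f.
Proof.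
move=> flin C0 fC.
pose f1 : {linear H -> K} := HB.pack f (GRing.isLinear.Build _ _ _ _ f flin).
have fcts : continuous f1.
  apply/linear_bounded_continuous/linear_boundedP.
  exists C; split; first exact: ger0_real.
  by move=> r Cr x; rewrite (le_trans (fC x))// ler_wpM2r// ltW.
pose h : {bounded H -> K} := HB.pack f (GRing.isLinear.Build _ _ _ _ f flin)
  (isContinuous.Build _ _ f fcts).
by exists h.
Qed.

Lemma complex_arch (e : R[i]) : 0 < e ->
  exists N, forall n, (N <= n)%N -> n.+1%:R^-1 < e.
Proof.
case: e => a b; rewrite ltcE /= => /andP[/eqP -> a0].
have [N Na] : exists N : nat, a^-1 < N.+1%:R.
  by exists (Num.truncn a^-1); rewrite truncnS_gt.
exists N => n Nn.
have -> : n.+1%:R^-1 = (n.+1%:R^-1)%:C :> R[i] by rewrite fmorphV rmorph_nat.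
rewrite ltcR -[ltRHS]invrK ltf_pV2 ?posrE ?invr_gt0//.
by rewrite (lt_le_trans Na)// ler_nat ltnS.
Qed.

Lemma cauchy_seq_cvg (H : completeNormedModType R[i]) (u : nat -> H) :
  (forall e : R[i], 0 < e ->
     exists N, forall n, (N <= n)%N -> `|u N - u n| < e) ->
  exists l, forall e : R[i], 0 < e -> exists N, forall n, (N <= n)%N -> `|l - u n| < e.
Proof.
move=> cu; have /cvg_ex[l ul] : cvg (u @ \oo).
  apply: cauchy_cvg; apply/cauchy_exP => e /cu[N uN].
  by exists (u N); exists N => // n /= /uN; rewrite -ball_normE.
exists l => e e0; have /cvgrPdist_lt/(_ _ e0)[N _ NP] := ul.
by exists N => n /NP.
Qed.

End Bounded.

Section Riesz.
Variable R : realType.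

Lemma le_eps (x y c : R[i]) : 0 <= c -> x \is Num.real -> y \is Num.real ->
  (forall e, 0 < e -> x <= y + c * e) -> x <= y.
Proof.
move=> c0 xr yr xy.
have [//|yx] := real_leP xr yr.
have c1 : 0 < c + 1 by rewrite ltr_wpDl.
have e0 : 0 < (x - y) / (c + 1) by rewrite !divr_gt0// ?subr_gt0.
have := xy _ e0; rewrite -lerBlDl => h.
suff : x - y < x - y by rewrite ltxx.
apply: (le_lt_trans h).
by rewrite mulrCA gtr_pMr ?subr_gt0// ltr_pdivrMr// mul1r ltrDl.
Qed.

Lemma riesz (H : hilbertType R) (phi : H -> R[i]) C : linear (phi : H -> R[i]^o) -> 0 <= C ->
  (forall x, `|phi x| <= C * `|x|) ->
  exists z, forall x, phi x = inner x z.
Proof.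
move=> phil C0 phiC.
pose p : {linear H -> R[i]^o} := HB.pack phi (GRing.isLinear.Build _ _ _ _ (phi : H -> R[i]^o) phil).
have phiB x y : phi (x - y) = phi x - phi y by exact: (linearB p).
have phiD x y : phi (x + y) = phi x + phi y by exact: (linearD p).
have phiZ a x : phi (a *: x) = a * phi x by exact: (linearZ_LR p).
have [p0|/existsNP[x0 /eqP px0]] := pselect (forall x, phi x = 0).
  by exists 0 => x; rewrite p0 linear0r.
have [q qE] : exists q : H -> R, forall x, (q x)%:C = `|x| ^+ 2.
  exists (fun x => complex.Re `|x| ^+ 2) => x.
  by rewrite rmorphXn /= RRe_real ?normr_real.
have q0 x : 0 <= q x by rewrite -lecR qE exprn_ge0.
pose D := [set q x | x in [set x | phi x = 1]].
have DS : has_inf D.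
  split; last by exists 0 => _ [x _ <-].
  exists (q ((phi x0)^-1 *: x0)); exists ((phi x0)^-1 *: x0) => //=.
  by rewrite phiZ mulVf.
pose d := inf D.
have dle x : phi x = 1 -> d <= q x.
  by move=> x1; apply: ge_inf; [exact: (proj2 DS)|exists x].
have /choice[u uP] : forall n : nat, exists x, phi x = 1 /\ q x < d + n.+1%:R^-1.
  move=> n; have [|_ [x x1 <-] xd] := @inf_adherent _ D n.+1%:R^-1 _ DS.
    by rewrite invr_gt0.
  by exists x.
have qm n m : q (u n - u m) <= 2 * n.+1%:R^-1 + 2 * m.+1%:R^-1.
  have [[u1 u2] [v1 v2]] := (uP n, uP m).
  have w1 : phi (2^-1 *: (u n + u m)) = 1.
    by rewrite phiZ phiD u1 v1; field.
  have := dle _ w1.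
  have -> : q (2^-1 *: (u n + u m)) = 4^-1 * q (u n + u m).
    apply: (@complexI R); rewrite rmorphM /= !qE normrZ exprMn; congr (_ * _).
    by rewrite fmorphV/= rmorph_nat normfV normr_nat; field.
  have : q (u n + u m) + q (u n - u m) = 2 * q (u n) + 2 * q (u m).
    apply: (@complexI R); rewrite !rmorphD/= !rmorphM /= !rmorph_nat !qE.
    exact: parallelogram.
  move: u2 v2; move: (n.+1%:R^-1) (m.+1%:R^-1) => i1 i2 u2 v2 h1 h2.
  lra.
have [l lP] : exists l, forall e : R[i], 0 < e ->
    exists N, forall n, (N <= n)%N -> `|l - u n| < e.
  apply: cauchy_seq_cvg => e e0.
  have e24 : 0 < e ^+ 2 / 4 by rewrite divr_gt0// exprn_gt0.
  have [N NP] := complex_arch e24; exists N => k Nk.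
  rewrite -(@ltr_pXn2r _ 2) ?nnegrE ?(ltW e0)// -qE.
  apply: (@le_lt_trans _ _ (2 * N.+1%:R^-1 + 2 * k.+1%:R^-1)).
    by have := qm N k; rewrite -lecR rmorphD !rmorphM !fmorphV !rmorph_nat.
  have h1 := NP _ (leqnn _); have h2 := NP _ Nk.
  have -> : e ^+ 2 = 2 * (e ^+ 2 / 4) + 2 * (e ^+ 2 / 4) by field.
  by rewrite ltrD// ltr_pM2l.
have l1 : phi l = 1.
  apply/eqP; rewrite -subr_eq0 -normr_le0.
  apply: (@le_eps _ _ C) => //; first exact: normr_real.
  move=> e /lP[N NP]; rewrite add0r.
  have [uN _] := uP N; rewrite -uN -phiB (le_trans (phiC _))//.
  by rewrite ler_wpM2l// ltW// NP.
have ort x : phi x = 0 -> inner x l = 0.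
  move=> x0'; apply/eqP; rewrite -normr_le0.
  have [->|xn0] := eqVneq x 0; first by rewrite linear0l normr0.
  have nx : 0 < `|x| by rewrite normr_gt0.
  apply: (@le_eps _ _ (2 * `|x|)) => //; [by rewrite mulr_ge0|exact: normr_real|].
  move=> e e0.
  rewrite add0r.
  have [N1 h1] := lP _ e0.
  have [N2 h2] := complex_arch (exprn_gt0 2 e0).
  pose n := maxn N1 N2.
  have {h1} h1 := h1 n (leq_maxl _ _); have {h2} h2 := h2 n (leq_maxr _ _).
  have [un1 un2] := uP n.
  have un3 : `|inner x (u n)| <= `|x| * e.
    pose t := inner (u n) x / `|x| ^+ 2.
    have w1 : phi (u n - t *: x) = 1.
      by rewrite phiB phiZ un1 x0' mulr0 subr0.
    have := le_lt_trans (dle _ w1) .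
    have : q (u n) < q (u n - t *: x) + n.+1%:R^-1.
      by rewrite (lt_le_trans un2)// lerD2r dle.
    rewrite -ltcR rmorphD/= !qE fmorphV/= rmorph_nat -!innerE.
    rewrite innerBl !innerBr !innerZl !innerZr.
    have -> : t * (t^* * inner x x) = t^* * inner (u n) x.
      by rewrite innerE /t mulrCA divfK// expf_neq0// normr_eq0.
    rewrite opprB addrA subrK -addrA ltrDl addrC subr_gt0 => h _.
    rewrite -(@ler_pXn2r _ 2) ?nnegrE ?mulr_ge0 ?(ltW e0)//.
    rewrite exprMn mulrC -ler_pdivrMr ?exprn_gt0// ltW// (lt_trans _ h2)//.
    apply: le_lt_trans h.
    by rewrite /t normCK -innerC [leRHS]mulrAC [inner x _ * _]mulrC.
  rewrite (_ : l = (l - u n) + u n); last by rewrite subrK.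
  rewrite innerDr (le_trans (ler_normD _ _))//.
  rewrite -[leRHS]mulrA mulr_natl mulr2n lerD//.
  by rewrite (le_trans (inner_CS _ _))// ler_wpM2l// ltW.
have ll : `|l| ^+ 2 != 0.
  rewrite expf_neq0// normr_eq0; apply/eqP => l0.
  by move/eqP: l1; rewrite l0 -(subrr 0) phiB subrr eq_sym oner_eq0.
exists (`|l| ^- 2 *: l) => x.
have : inner (x - phi x *: l) l = 0.
  by apply: ort; rewrite phiB phiZ l1 mulr1 subrr.
rewrite innerBl innerZl => /eqP; rewrite subr_eq0 innerZr => /eqP ->.
rewrite innerE fmorphV rmorphXn /= (CrealP (normr_real _)) mulrCA mulVf ?mulr1//.
Qed.


Lemma adjoint_exists (H K : hilbertType R) (f : {bounded H -> K}) :
  exists g : {bounded K -> H}, forall x y, inner (f x) y = inner x (g y).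
Proof.
have [C C0 fC] := bounded_le f.
have /choice[g gP] : forall y, exists z, forall x, inner (f x) y = inner x z.
  move=> y; apply: (@riesz _ (fun x => inner (f x) y) (C * `|y|)).
  - by move=> a x x'; rewrite linearP innerDl innerZl.
  - by rewrite mulr_ge0// ltW.
  - move=> x; rewrite (le_trans (inner_CS _ _))//.
    by rewrite mulrAC ler_wpM2r.
have glin : linear g.
  move=> a y y'; apply: inner_inj => x.
  by rewrite -gP !innerDr !innerZr -!gP.
have [y|h hg] := ex_bounded glin (ltW C0).
  rewrite /=; have [->|gy0] := eqVneq (g y) 0.
    by rewrite normr0 mulr_ge0// ltW.
  have ng : 0 < `|g y| by rewrite normr_gt0.
  rewrite -(ler_pM2l ng) -expr2 -innerE -gP.
  rewrite -[leLHS]ger0_norm ?gP ?innerE ?exprn_ge0// -innerE -gP.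
  rewrite (le_trans (inner_CS _ _))//.
  by rewrite mulrA [`|g y| * C]mulrC ler_wpM2r.
by exists h => x y; rewrite hg.
Qed.

Lemma bounded_extension (A B : hilbertType R) (I : Type)
    (a : I -> A) (b : I -> B) (C : R[i]) : 0 <= C ->
  (forall s : seq (R[i] * I), `|\sum_(p <- s) p.1 *: b p.2| <=
                              C * `|\sum_(p <- s) p.1 *: a p.2|) ->
  (forall t e, 0 < e ->
     exists s : seq (R[i] * I), `|t - \sum_(p <- s) p.1 *: a p.2| < e) ->
  exists h : {bounded A -> B}, forall i, h (a i) = b i.
Proof.
move=> C0 ba da.
pose la (s : seq (R[i] * I)) := \sum_(p <- s) p.1 *: a p.2.
pose lb (s : seq (R[i] * I)) := \sum_(p <- s) p.1 *: b p.2.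
have dba s s' : `|lb s - lb s'| <= C * `|la s - la s'|.
  have E (V : lmodType R[i]) (c : I -> V) :
      \sum_(p <- s ++ [seq (- p.1, p.2) | p <- s']) p.1 *: c p.2 =
      \sum_(p <- s) p.1 *: c p.2 - \sum_(p <- s') p.1 *: c p.2.
    rewrite big_cat big_map/= -sumrN; congr (_ + _).
    by apply: eq_bigr => p _; rewrite scaleNr.
  by rewrite /la /lb -!E ba.
have /choice[h hP] : forall t, exists y, forall s, `|y - lb s| <= C * `|t - la s|.
  move=> t.
  have /choice[u uP] : forall n : nat, exists s, `|t - la s| < n.+1%:R^-1.
    by move=> n; apply: da; rewrite invr_gt0.
  have [y yP] : exists l, forall e : R[i], 0 < e ->
      exists N, forall n, (N <= n)%N -> `|l - lb (u n)| < e.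
    apply: cauchy_seq_cvg => e e0.
    have C1 : 0 < C + 1 by rewrite ltr_wpDl.
    have e2 : 0 < e / (C + 1) / 2 by rewrite !divr_gt0.
    have [N NP] := complex_arch e2; exists N => n Nn.
    rewrite (le_lt_trans (dba _ _))//.
    have : `|la (u N) - la (u n)| < e / (C + 1).
      rewrite -(subrK t (la (u N))) -addrA (le_lt_trans (ler_normD _ _))//.
      rewrite [ltRHS]splitr ltrD// ?[`|la _ - t|]distrC.
        by rewrite (lt_trans (uP _))// NP.
      by rewrite (lt_trans (uP _))// NP.
    rewrite ltr_pdivlMr// mulrDr mulr1 mulrC => /(le_lt_trans _); apply.
    by rewrite lerDl.
  exists y => s.
  apply: (@le_eps _ _ (1 + C)); [by rewrite addr_ge0|exact: normr_real| |].
    by rewrite realM// ?ger0_real// normr_real.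
  move=> e e0; have [N1 h1] := yP _ e0; have [N2 h2] := complex_arch e0.
  pose n := maxn N1 N2.
  have {h1} h1 := h1 n (leq_maxl _ _); have {h2} h2 := h2 n (leq_maxr _ _).
  rewrite -(subrK (lb (u n)) y) -addrA (le_trans (ler_normD _ _))//.
  rewrite mulrDl mul1r addrCA lerD ?(ltW h1)// (le_trans (dba _ _))//.
  rewrite -mulrDr ler_wpM2l// -(subrK t (la (u n))) -addrA.
  rewrite (le_trans (ler_normD _ _))// [leLHS]addrC lerD2l distrC ltW//.
  exact: lt_trans (uP _) h2.
have hla s : h (la s) = lb s.
  apply/eqP; rewrite -subr_eq0 -normr_le0.
  by rewrite (le_trans (hP _ s))// subrr normr0 mulr0.
have hlin : linear h.
  move=> k t u; apply/eqP; rewrite -subr_eq0 -normr_le0.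
  apply: (@le_eps _ _ (2 * C * (`|k| + 1))).
  - by rewrite !mulr_ge0// addr_ge0.
  - exact: normr_real.
  - exact: real0.
  move=> e e0; rewrite add0r.
  have [s st] := da t e e0; have [s' su] := da u e e0.
  pose s2 := [seq (k * p.1, p.2) | p <- s] ++ s'.
  have la2 : la s2 = k *: la s + la s'.
    rewrite /la big_cat big_map/= scaler_sumr; congr (_ + _).
    by apply: eq_bigr => p _; rewrite scalerA.
  have lb2 : lb s2 = k *: lb s + lb s'.
    rewrite /lb big_cat big_map/= scaler_sumr; congr (_ + _).
    by apply: eq_bigr => p _; rewrite scalerA.
  have E0 (X : zmodType) (x y z w : X) : x + y - (z + w) = (x - z) + (y - w).
    by rewrite opprD addrACA.
  rewrite -(subrK (lb s2) (h (k *: t + u))) -addrA.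
  rewrite (le_trans (ler_normD _ _))//.
  have -> : 2 * C * (`|k| + 1) * e = C * (`|k| * e + e) + (`|k| * (C * e) + C * e).
    by ring.
  rewrite lerD//.
    rewrite (le_trans (hP _ s2))// ler_wpM2l// la2 E0 -scalerBr.
    by rewrite (le_trans (ler_normD _ _))// normrZ lerD// ?ler_wpM2l// ltW.
  rewrite lb2 E0 -scalerBr (le_trans (ler_normD _ _))// normrZ.
  rewrite ![`|lb _ - _|]distrC lerD// ?ler_wpM2l//.
    by rewrite (le_trans (hP _ s))// ler_wpM2l// ltW.
  by rewrite (le_trans (hP _ s'))// ler_wpM2l// ltW.
have [t|g gh] := ex_bounded hlin C0.
  by have := hP t [::]; rewrite /la /lb !big_nil !subr0.
exists g => i; rewrite gh.
by have := hla [:: (1, i)]; rewrite /la /lb !big_seq1 !scale1r.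
Qed.

End Riesz.

Definition adjoint (R : realType) (H K : hilbertType R) (f : {bounded H -> K}) :
  {bounded K -> H} := projT1 (cid (adjoint_exists f)).

Lemma adjointP (R : realType) (H K : hilbertType R) (f : {bounded H -> K}) x y :
  inner (f x) y = inner x (adjoint f y).
Proof. by rewrite /adjoint; case: cid => g /= ->. Qed.

(* A Hilbert space tensor product of H and K: a completion of the algebraic
   tensor product for the inner product <x (x) y, x' (x) y'> = <x, x'> <y, y'>.
   It is determined up to a unique unitary map compatible with tensor.  Scalars
   are absorbed by the first factor, so the finite sums of simple tensors are
   already the whole linear span. *)
Record hilbertTensor (R : realType) (H K : hilbertType R) := HilbertTensor {
  tensor_space :> hilbertType R;
  tensor : {bilinear H -> K -> tensor_space};
  inner_tensor : forall x x' y y',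
    inner (tensor x y) (tensor x' y') = inner x x' * inner y y';
  dense_tensor :
    dense [set \sum_(p <- s) tensor p.1 p.2 | s in [set: seq (H * K)]]
}.

(* The linear span of the family a is dense. *)
Definition total_family (R : realType) (H : hilbertType R) (I : Type)
    (a : I -> H) :=
  forall t (e : R[i]), 0 < e ->
    exists s : seq (R[i] * I), `|t - \sum_(p <- s) p.1 *: a p.2| < e.

Lemma eq_total_family (R : realType) (A B : hilbertType R) (I : Type)
    (a : I -> A) (f g : {bounded A -> B}) :
  total_family a -> (forall i, f (a i) = g (a i)) -> f =1 g.
Proof.
move=> ta fg t; have [C C0 fC] := bounded_le f; have [D D0 gD] := bounded_le g.
apply/eqP; rewrite -subr_eq0 -normr_le0.
apply: (@le_eps _ _ _ (C + D)); rewrite ?normr_real ?addr_ge0 ?(ltW C0) ?(ltW D0)//.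
move=> e /(ta t)[s]; set u := \sum_(p <- s) _ => /ltW tu.
have fgu : f u = g u.
  rewrite !linear_sum; apply: eq_bigr => p _.
  transitivity (p.1 *: f (a p.2)); first exact: linearZ_LR.
  by rewrite fg; symmetry; exact: linearZ_LR.
rewrite add0r -(subrK (f u) (f t)) -addrA {2}fgu -!linearB.
rewrite (le_trans (ler_normD _ _))// mulrDl lerD//.
  by rewrite (le_trans (fC _))// ler_wpM2l// ltW.
by rewrite (le_trans (gD _))// distrC ler_wpM2l// ltW.
Qed.

Section TensorTheory.
Variable R : realType.

Lemma total_tensor (H K : hilbertType R) (T : hilbertTensor H K) :
  total_family (fun i : H * K => tensor T i.1 i.2).
Proof.
move=> t e e0.
have ne : ball t e !=set0 by exists t; exact: ballxx.
have [x [xB [s _ sx]]] := dense_tensor (h := T) ne (ball_open t e).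
move: xB; rewrite -ball_normE/= -sx => h; exists [seq (1, p) | p <- s].
by rewrite big_map/=; under eq_bigr do rewrite scale1r.
Qed.

Lemma norm_tensor (H K : hilbertType R) (T : hilbertTensor H K) x y :
  `|tensor T x y| = `|x| * `|y|.
Proof.
apply/eqP; rewrite -(@eqrXn2 _ 2) ?mulr_ge0//.
by rewrite -innerE inner_tensor !innerE exprMn.
Qed.

Lemma total_tensor_pair (H K : hilbertType R) (T : hilbertTensor H K)
    (I J : Type) (a : I -> H) (b : J -> K) :
  total_family a -> total_family b ->
  total_family (fun p : I * J => tensor T (a p.1) (b p.2)).
Proof.
move=> da db.
pose c (p : I * J) := tensor T (a p.1) (b p.2).
pose ap t := forall e : R[i], 0 < e ->
  exists s : seq (R[i] * (I * J)), `|t - \sum_(p <- s) p.1 *: c p.2| < e.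
have apD t u : ap t -> ap u -> ap (t + u).
  move=> apt apu e e0.
  have e2 : 0 < e / 2 by rewrite divr_gt0.
  have [s1 h1] := apt _ e2; have [s2 h2] := apu _ e2.
  exists (s1 ++ s2); rewrite big_cat/= opprD addrACA.
  by rewrite (le_lt_trans (ler_normD _ _))// [ltRHS]splitr ltrD.
have apT x y : ap (tensor T x y).
  move=> e e0.
  have e1 : 0 < e / 2 / (`|y| + 1) by rewrite !divr_gt0// ltr_wpDl.
  have [s1 h1] := da x _ e1; set x1 := \sum_(p <- s1) _ in h1.
  have e2 : 0 < e / 2 / (`|x1| + 1) by rewrite !divr_gt0// ltr_wpDl.
  have [s2 h2] := db y _ e2; set y1 := \sum_(p <- s2) _ in h2.
  exists [seq (p.1 * q.1, (p.2, q.2)) | p <- s1, q <- s2].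
  rewrite big_allpairs_dep/=.
  rewrite [X in _ - X](_ : _ = tensor T x1 y1); last first.
    rewrite /x1 linear_sumlz; apply: eq_bigr => p _.
    rewrite /y1 linear_sumr; apply: eq_bigr => q _.
    by rewrite linearZl_LR linearZr_LR/= scalerA.
  have -> : tensor T x y - tensor T x1 y1 =
            tensor T (x - x1) y + tensor T x1 (y - y1).
    by rewrite linearBl linearBr addrA subrK.
  rewrite (le_lt_trans (ler_normD _ _))// !norm_tensor [ltRHS]splitr ltrD//.
    move: h1; rewrite ltr_pdivlMr ?ltr_wpDl//; apply: le_lt_trans.
    by rewrite ler_wpM2l// lerDl.
  move: h2; rewrite ltr_pdivlMr ?ltr_wpDl//; apply: le_lt_trans.
  by rewrite mulrC ler_wpM2l// lerDl.
move=> t e e0.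
have e2 : 0 < e / 2 by rewrite divr_gt0.
have [s hs] := @total_tensor _ _ T t _ e2.
have aps : ap (\sum_(p <- s) p.1 *: tensor T p.2.1 p.2.2).
  elim: s {hs} => [|p s IH].
    by move=> r r0; exists [::]; rewrite !big_nil subrr normr0.
  by rewrite big_cons; apply: apD => //; rewrite -linearZl_LR.
have [s' hs'] := aps _ e2; exists s'.
rewrite -(subrK (\sum_(p <- s) p.1 *: tensor T p.2.1 p.2.2) t) -addrA.
by rewrite (le_lt_trans (ler_normD _ _))// [ltRHS]splitr ltrD.
Qed.

Lemma inner_expand (K : hilbertType R) (ys : seq K) :
  exists es : seq K, forall y y', y \in ys ->
    inner y y' = \sum_(e <- es) inner y e * inner e y'.
Proof.
suff [es [ues oes yes]] : exists es : seq K, [/\ uniq es,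
    {in es &, forall e e', inner e e' = (e == e')%:R} &
    {in ys, forall y, y = \sum_(e <- es) inner y e *: e}].
  exists es => y y' /yes {1}->.
  by rewrite inner_suml; apply: eq_bigr => e _; rewrite innerZl.
elim: ys => [|y ys [es [ues oes yes]]]; first by exists [::].
pose r := y - \sum_(e <- es) inner y e *: e.
have re e : e \in es -> inner r e = 0.
  move=> ee; rewrite innerBl inner_suml (bigD1_seq e)//= innerZl.
  rewrite (oes _ _ ee ee) eqxx mulr1 big_seq_cond big1 ?addr0 ?subrr//.
  by move=> e' /andP[ee' /negPf ne]; rewrite innerZl (oes _ _ ee' ee) ne mulr0.
have [r0|rn0] := eqVneq r 0.
  exists es; split => // z; rewrite inE => /predU1P[->|/yes//].
  by apply/eqP; rewrite -subr_eq0; apply/eqP.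
have nr : `|r| != 0 by rewrite normr_eq0.
pose e0 := `|r|^-1 *: r.
have e00 : inner e0 e0 = 1.
  rewrite innerZl innerZr innerE fmorphV/= (CrealP (normr_real _)).
  by rewrite expr2 mulKf// mulVf.
have e0e e : e \in es -> inner e0 e = 0 by move=> /re h; rewrite innerZl h mulr0.
have ee0 e : e \in es -> inner e e0 = 0.
  by move=> /e0e h; rewrite innerC h rmorph0.
have e0n : e0 \notin es.
  by apply/negP => /e0e; rewrite e00 => /eqP; rewrite oner_eq0.
exists (e0 :: es); split => /=.
- by rewrite e0n.
- move=> e e'; rewrite !inE => /predU1P[->|ee] /predU1P[->|ee'].
  + by rewrite e00 eqxx.
  + by rewrite e0e//; case: eqP => // h; rewrite -h (negPf e0n) in ee'.
  + by rewrite ee0//; case: eqP => // h; rewrite h (negPf e0n) in ee.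
  + exact: oes.
- move=> z; rewrite inE big_cons => /predU1P[->|zys].
    have yr : y = r + \sum_(e <- es) inner y e *: e by rewrite subrK.
    rewrite {1}yr; congr (_ + _).
    rewrite innerZr fmorphV/= (CrealP (normr_real _)) scalerA.
    have -> : inner y r = `|r| ^+ 2.
      rewrite {1}yr innerDl innerE inner_suml big_seq big1 ?addr0// => e ee.
      by rewrite innerZl [inner e r]innerC re// rmorph0 mulr0.
    by rewrite expr2 mulKf// divff// scale1r.
  have -> : inner z e0 = 0.
    rewrite (yes _ zys) inner_suml big_seq big1// => e ee.
    by rewrite innerZl ee0// mulr0.
  by rewrite scale0r add0r -yes.
Qed.

Let gram (H K : hilbertType R) (s : seq (H * K)) :=
  \sum_(p <- s) \sum_(q <- s) inner p.1 q.1 * inner p.2 q.2.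

Lemma norm_tensor_sum (H K : hilbertType R) (T : hilbertTensor H K) s :
  `|\sum_(p <- s) tensor T p.1 p.2| ^+ 2 = gram s.
Proof.
rewrite -innerE inner_suml; apply: eq_bigr => p _.
by rewrite inner_sumr; apply: eq_bigr => q _; rewrite inner_tensor.
Qed.

Lemma gram_expand (H K : hilbertType R) (s : seq (H * K)) :
  exists es : seq K, forall (H' : hilbertType R) (f : {linear H -> H'}),
    gram [seq (f p.1, p.2) | p <- s] =
    \sum_(e <- es) `|f (\sum_(p <- s) inner p.2 e *: p.1)| ^+ 2.
Proof.
have [es esP] := inner_expand [seq p.2 | p <- s].
exists es => H' f; rewrite /gram !big_map.
under eq_bigr do rewrite big_map /=.
transitivity (\sum_(p <- s) \sum_(q <- s) \sum_(e <- es)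
   inner (f p.1) (f q.1) * (inner p.2 e * inner e q.2)).
  rewrite big_seq [RHS]big_seq; apply: eq_bigr => p ps; apply: eq_bigr => q _.
  by rewrite -mulr_sumr esP// map_f.
under eq_bigr do rewrite exchange_big/=.
rewrite exchange_big /=; apply: eq_bigr => e _.
rewrite -innerE linear_sum inner_suml; apply: eq_bigr => p _.
rewrite inner_sumr; apply: eq_bigr => q _.
have fZ a x : f (a *: x) = a *: f x by exact: linearZ_LR.
by rewrite !fZ innerZl innerZr -innerC mulrC -mulrA.
Qed.

Lemma gram_le (H K H' : hilbertType R) (s : seq (H * K)) (f : {linear H -> H'}) C :
  (forall x, `|f x| <= C * `|x|) ->
  gram [seq (f p.1, p.2) | p <- s] <= C ^+ 2 * gram s.
Proof.
move=> fC; have [es esP] := gram_expand s.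
have := esP _ idfun; rewrite map_id_in; last by case.
move=> ->; rewrite esP mulr_sumr ler_sum// => e _.
by rewrite -exprMn lerXn2r ?nnegrE// (le_trans _ (fC _)).
Qed.

Lemma gram_swap (H K : hilbertType R) (s : seq (H * K)) :
  gram [seq (p.2, p.1) | p <- s] = gram s.
Proof.
rewrite /gram big_map; apply: eq_bigr => p _.
by rewrite big_map; apply: eq_bigr => q _; rewrite mulrC.
Qed.

Lemma tensor_map_exists (H K H' K' : hilbertType R)
    (T : hilbertTensor H K) (T' : hilbertTensor H' K')
    (f : {bounded H -> H'}) (g : {bounded K -> K'}) :
  exists h : {bounded T -> T'},
    forall x y, h (tensor T x y) = tensor T' (f x) (g y).
Proof.
have [C C0 fC] := bounded_le f; have [D D0 gD] := bounded_le g.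
suff [h hP] : exists h : {bounded T -> T'}, forall p : H * K,
    h (tensor T p.1 p.2) = tensor T' (f p.1) (g p.2).
  by exists h => x y; rewrite (hP (x, y)).
apply: (@bounded_extension _ _ _ _ _ _ (C * D)) => [|s|].
- by rewrite mulr_ge0// ltW.
- pose s1 := [seq (p.1 *: p.2.1, p.2.2) | p <- s].
  have -> : \sum_(p <- s) p.1 *: tensor T p.2.1 p.2.2 =
            \sum_(p <- s1) tensor T p.1 p.2.
    by rewrite big_map; apply: eq_bigr => p _; rewrite /= linearZl_LR.
  have -> : \sum_(p <- s) p.1 *: tensor T' (f p.2.1) (g p.2.2) =
      \sum_(p <- [seq (f p.1, g p.2) | p <- s1]) tensor T' p.1 p.2.
    rewrite !big_map; apply: eq_bigr => p _ /=.
    by rewrite linearZ linearZl_LR.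
  rewrite -(@ler_pXn2r _ 2) ?nnegrE ?mulr_ge0 ?(ltW C0) ?(ltW D0)//.
  rewrite exprMn !norm_tensor_sum exprMn.
  have -> : [seq (f p.1, g p.2) | p <- s1] =
            [seq (f p.1, p.2) | p <- [seq (p.1, g p.2) | p <- s1]].
    by rewrite -[RHS]map_comp; exact: eq_map.
  rewrite (le_trans (gram_le _ fC))// -mulrA ler_wpM2l ?exprn_ge0 ?(ltW C0)//.
  rewrite -gram_swap -(gram_swap s1) -map_comp.
  have -> : [seq ((fun p => (p.2, p.1)) \o (fun p => (p.1, g p.2))) p | p <- s1] =
            [seq (g p.1, p.2) | p <- [seq (p.2, p.1) | p <- s1]].
    by rewrite -[RHS]map_comp.
  exact: gram_le.
- exact: total_tensor.
Qed.

Lemma isometry_extension (A B : hilbertType R) (I : Type) (a : I -> A) (b : I -> B) :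
  (forall i j, inner (b i) (b j) = inner (a i) (a j)) -> total_family a ->
  exists h : {bounded A -> B}, forall i, h (a i) = b i.
Proof.
move=> ab da; apply: (@bounded_extension _ _ _ _ _ _ 1) => // s.
rewrite mul1r -(@ler_pXn2r _ 2) ?nnegrE// -!innerE !inner_suml.
rewrite le_eqVlt; apply/orP; left; apply/eqP; apply: eq_bigr => p _.
by rewrite !inner_sumr; apply: eq_bigr => q _; rewrite !innerZl !innerZr ab.
Qed.

Variables (H K L : hilbertType R).
Variables (HK : hilbertTensor H K) (KL : hilbertTensor K L).
Variables (HK_L : hilbertTensor HK L) (H_KL : hilbertTensor H KL).

Lemma total_idfun (V : hilbertType R) : total_family (@idfun V).
Proof.
by move=> t e e0; exists [:: (1, t)]; rewrite big_seq1 scale1r subrr normr0.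
Qed.

Lemma tensor_assoc_exists : exists h : {bounded HK_L -> H_KL}, forall x y z,
  h (tensor HK_L (tensor HK x y) z) = tensor H_KL x (tensor KL y z).
Proof.
have [||h hP] := @isometry_extension HK_L H_KL (H * K * L)
  (fun p => tensor HK_L (tensor HK p.1.1 p.1.2) p.2)
  (fun p => tensor H_KL p.1.1 (tensor KL p.1.2 p.2)).
- by move=> i j; rewrite !inner_tensor mulrA.
- exact: (@total_tensor_pair _ _ HK_L _ _ _ _ (@total_tensor _ _ HK) (@total_idfun L)).
by exists h => x y z; rewrite (hP (x, y, z)).
Qed.

Lemma tensor_assocV_exists : exists h : {bounded H_KL -> HK_L}, forall x y z,
  h (tensor H_KL x (tensor KL y z)) = tensor HK_L (tensor HK x y) z.
Proof.
have [||h hP] := @isometry_extension H_KL HK_L (H * (K * L))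
  (fun p => tensor H_KL p.1 (tensor KL p.2.1 p.2.2))
  (fun p => tensor HK_L (tensor HK p.1 p.2.1) p.2.2).
- by move=> i j; rewrite !inner_tensor mulrA.
- exact: (@total_tensor_pair _ _ H_KL _ _ _ _ (@total_idfun H) (@total_tensor _ _ KL)).
by exists h => x y z; rewrite (hP (x, (y, z))).
Qed.

End TensorTheory.

(* The unique bounded linear map sending x (x) y to f x (x) g y. *)
Definition tensor_map (R : realType) (H K H' K' : hilbertType R)
    (T : hilbertTensor H K) (T' : hilbertTensor H' K')
    (f : {bounded H -> H'}) (g : {bounded K -> K'}) : {bounded T -> T'} :=
  projT1 (cid (tensor_map_exists T T' f g)).

Lemma tensor_mapE (R : realType) (H K H' K' : hilbertType R)
    (T : hilbertTensor H K) (T' : hilbertTensor H' K')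
    (f : {bounded H -> H'}) (g : {bounded K -> K'}) x y :
  tensor_map T T' f g (tensor T x y) = tensor T' (f x) (g y).
Proof. by rewrite /tensor_map; case: cid => h /= ->. Qed.

(* The canonical unitary (H (x) K) (x) L -> H (x) (K (x) L) and its inverse. *)
Section Associator.
Variables (R : realType) (H K L : hilbertType R).
Variables (HK : hilbertTensor H K) (KL : hilbertTensor K L).
Variables (HK_L : hilbertTensor HK L) (H_KL : hilbertTensor H KL).

Definition tensor_assoc : {bounded HK_L -> H_KL} :=
  projT1 (cid (tensor_assoc_exists HK_L H_KL)).

Definition tensor_assocV : {bounded H_KL -> HK_L} :=
  projT1 (cid (tensor_assocV_exists HK_L H_KL)).

Lemma tensor_assocE x y z :
  tensor_assoc (tensor HK_L (tensor HK x y) z) = tensor H_KL x (tensor KL y z).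
Proof. by rewrite /tensor_assoc; case: cid => h /= ->. Qed.

Lemma tensor_assocVE x y z :
  tensor_assocV (tensor H_KL x (tensor KL y z)) = tensor HK_L (tensor HK x y) z.
Proof. by rewrite /tensor_assocV; case: cid => h /= ->. Qed.

Lemma tensor_assocK : cancel tensor_assoc tensor_assocV.
Proof.
pose f : {bounded HK_L -> HK_L} := tensor_assocV \o tensor_assoc.
pose g : {bounded HK_L -> HK_L} := idfun.
suff : f =1 g by [].
apply: (eq_total_family (total_tensor_pair (total_tensor (T := HK))
  (total_idfun (V := L)))) => -[[x y] z].
by rewrite /f /g /= tensor_assocE tensor_assocVE.
Qed.

Lemma tensor_assocVK : cancel tensor_assocV tensor_assoc.
Proof.
pose f : {bounded H_KL -> H_KL} := tensor_assoc \o tensor_assocV.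
pose g : {bounded H_KL -> H_KL} := idfun.
suff : f =1 g by [].
apply: (eq_total_family (total_tensor_pair (total_idfun (V := H))
  (total_tensor (T := KL)))) => -[x [y z]].
by rewrite /f /g /= tensor_assocVE tensor_assocE.
Qed.

End Associator.

Section HilbertianAlgebra.
Variables (R : realType) (H : hilbertType R) (HH : hilbertTensor H H).
Variable mu : {bounded HH -> H}.

Definition hmul (x y : H) : H := mu (tensor HH x y).

Fact hmul_linear u : linear (hmul u).
Proof. by move=> a x y; rewrite /hmul linearDr linearZr_LR/= linearP. Qed.

Fact hmul_continuous u : continuous (hmul u).
Proof.
have [C C0 muC] := bounded_le mu.
have [|x|h hE] := ex_bounded (@hmul_linear u) (C := C * `|u|).
- by rewrite mulr_ge0// ltW.
- by rewrite (le_trans (muC _))// norm_tensor mulrA.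
by rewrite -(funext hE); exact: cts_fun.
Qed.

HB.instance Definition _ u :=
  GRing.isLinear.Build _ _ _ _ (hmul u) (@hmul_linear u).
HB.instance Definition _ u :=
  isContinuous.Build _ _ (hmul u) (@hmul_continuous u).

Definition regular_rep (u : H) : {bounded H -> H} := hmul u.

Definition hilbertian_algebra := associative hmul /\ commutative hmul.

Definition frobenius (HH_H : hilbertTensor HH H) (H_HH : hilbertTensor H HH) :=
  let idH : {bounded H -> H} := idfun in
  let mud := adjoint mu in
  tensor_map HH_H HH mu idH \o tensor_assocV HH_H H_HH
    \o tensor_map HH H_HH idH mud =1 mud \o mu /\
  mud \o mu =1 tensor_map H_HH HH idH mu \o tensor_assoc HH_H H_HH
    \o tensor_map HH HH_H mud idH.

Definition special := mu \o adjoint mu =1 idfun.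

(* The product of a Hilbertian algebra is commutative, so that one-sided and
   two-sided notions agree in the definitions below. *)
Definition algebra_ideal (I : set H) :=
  [/\ I 0, forall (a : R[i]) x y, I x -> I y -> I (a *: x + y)
    & forall x y, I y -> I (hmul x y)].

Definition modular (I : set H) := exists e, forall x, I (x - hmul e x).

Definition maximal_modular_ideal (I : set H) :=
  [/\ algebra_ideal I, modular I, I <> setT
    & forall J, algebra_ideal J -> I `<=` J -> J <> setT -> J = I].

(* This is the whole of H when there is no maximal modular ideal. *)
Definition jacobson_radical : set H :=
  \bigcap_(I in [set I | maximal_modular_ideal I]) I.

Definition semisimple := jacobson_radical = [set 0].

Definition faithful := [set u | regular_rep u =1 cst 0] = [set 0].

End HilbertianAlgebra.

Definition hilbertian_frobenius_semigroup (R : realType) (H : hilbertType R)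
    (HH : hilbertTensor H H)
    (HH_H : hilbertTensor HH H) (H_HH : hilbertTensor H HH)
    (mu : {bounded HH -> H}) :=
  hilbertian_algebra mu /\ frobenius mu HH_H H_HH.

(* Main.v *)
Require Import Defs.
From HB Require Import structures.
From mathcomp Require Import all_boot all_order all_algebra sesquilinear.
From mathcomp Require Import complex ring lra.
From mathcomp Require Import boolp classical_sets functions reals.
From mathcomp Require Import topology normedtype.

Import Order.TTheory GRing.Theory Num.Theory.
Import numFieldNormedType.Exports.

(** Write M_y for multiplication by y and M_y^* for its Hilbert adjoint.

    The Frobenius equation makes every M_y^* a multiplier, i.e.
    M_y^* (ab) = a M_y^* b (adjoint_regular_rep_multiplier): M_y^* is mu^dagger
    followed by the slice map p (x) q |-> <q, y> p, and multiplying the first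
    tensor factor by a commutes with that slice map.  Hence M_y commutes with
    M_y^*, so that M_y is normal and |yu| = |M_y^* u|.  Consequently u is
    annihilated by every y if and only if u is orthogonal to all products,
    i.e. mu^dagger u = 0.  This identifies the kernel of the regular
    representation with that of mu^dagger, and the link between the
    injectivity of mu^dagger, that of mu mu^dagger and the density of the range
    of mu is general Hilbert space theory.

    An annihilator lies in every maximal modular ideal, so a semisimple algebra
    is faithful.  Conversely let u be in the radical and suppose that M_u is
    not zero.  Since M_u^* is a multiplier, it preserves the radical, and
    w = M_u^* u is an element of the radical with M_w = M_u^* M_u.  The positive
    operator M_u^* M_u is nonzero, and r = |M_u|^2 > 0 is in its approximate
    spectrum (adjoint_mul_not_bounded_below).  But w / r is in the radical, hence
    has a quasi-inverse v (jacobson_quasi_inverse), and 1 + M_v is a bounded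
    left inverse of 1 - M_w / r, a contradiction.  So M_u = 0, and
    faithfulness gives u = 0. *)

(** * Hilbert spaces and adjoints *)

Section Hilbert.
Local Open Scope classical_set_scope.
Local Open Scope complex_scope.
Local Open Scope ring_scope.

Context {R : realType}.

(** Norms are valued in the complex numbers, which are only partially ordered;
    infima and suprema have to be taken over this real-valued square. *)
Lemma real_sqr_norm (H : hilbertType R) :
  exists q : H -> R, forall x, (q x)%:C = `|x| ^+ 2.
Proof.
exists (fun x => complex.Re `|x| ^+ 2) => x.
by rewrite rmorphXn /= RRe_real ?normr_real.
Qed.

(** If t w is the component of z along w, then |z - t w|^2 = |z|^2 - |t w|^2, so
    that minimality forces t = 0. *)
Lemma orthogonal_of_minimal_norm {H : hilbertType R} (W : set H) (z : H) :
  (forall (a : R[i]) w, W w -> W (a *: w)) ->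
  (forall w, W w -> `|z| <= `|z - w|) -> forall w, W w -> inner z w = 0.
Proof.
move=> WZ zmin w Ww.
have [->|w0] := eqVneq w 0; first by rewrite linear0r.
have ww0 : 0 < `|w| ^+ 2 by rewrite exprn_gt0// normr_gt0.
pose t := inner z w / `|w| ^+ 2.
have /zmin : W (t *: w) by exact: WZ.
rewrite -(@ler_pXn2r _ 2) ?nnegrE// -!innerE innerBl !innerBr !innerZl !innerZr.
have -> : t * (t^* * inner w w) = t^* * inner z w.
  by rewrite innerE /t mulrCA divfK// gt_eqF.
rewrite opprB addrA subrK lerDl oppr_ge0.
have -> : t * inner w z = `|inner z w| ^+ 2 / `|w| ^+ 2.
  by rewrite /t normCK -innerC mulrAC.
rewrite ler_pdivrMr// mul0r => h.
apply/eqP; rewrite -normr_eq0 -sqrf_eq0.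
by rewrite eq_le h exprn_ge0.
Qed.

Lemma ler_add_of_sqr {F : numDomainType} (x y e : F) : 0 <= x -> 0 <= y -> 0 <= e ->
  x ^+ 2 <= y ^+ 2 + e ^+ 2 -> x <= y + e.
Proof.
move=> x0 y0 e0 h; rewrite -(@ler_pXn2r _ 2) ?nnegrE ?addr_ge0//.
by rewrite (le_trans h)// sqrrD lerD2r lerDl mulrn_wge0 ?mulr_ge0.
Qed.

(** The point l is the orthogonal projection of v on the closure of W: the limit
    of a sequence in W minimizing the distance to v, which is a Cauchy sequence
    by the parallelogram identity. *)
Lemma orthogonal_projection {H : hilbertType R} (W : set H) (v : H) :
  W 0 -> (forall (a : R[i]) x y, W x -> W y -> W (a *: x + y)) ->
  exists l, (forall e : R[i], 0 < e -> exists2 w, W w & `|l - w| < e) /\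
            forall w, W w -> inner (v - l) w = 0.
Proof.
move=> W0 Wlin.
have WZ (a : R[i]) w : W w -> W (a *: w) by move=> Ww; rewrite -[_ *: _]addr0; apply: Wlin.
have WD x y : W x -> W y -> W (x + y) by move=> Wx Wy; rewrite -[x]scale1r; apply: Wlin.
have [q qE] := real_sqr_norm H.
have q0 x : 0 <= q x by rewrite -lecR qE exprn_ge0.
pose D := [set q (v - w) | w in W].
have DS : has_inf D.
  by split; [exists (q (v - 0)), 0|exists 0 => _ [x _ <-]].
have /choice[u uP] : forall n : nat, exists w, W w /\ q (v - w) < inf D + n.+1%:R^-1.
  move=> n; have [|_ [x x1 <-] xd] := @inf_adherent _ D n.+1%:R^-1 _ DS.
    by rewrite invr_gt0.
  by exists x.
have Wu n : W (u n) := proj1 (uP n).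
have umin n w : W w -> q (v - u n) <= q (v - w) + n.+1%:R^-1.
  move=> Ww; rewrite (le_trans (ltW (proj2 (uP n))))// lerD2r.
  by apply: ge_inf; [exact: (proj2 DS)|exists w].
have qm n m : q (u n - u m) <= 2 * n.+1%:R^-1 + 2 * m.+1%:R^-1.
  (* The midpoint of u n and u m competes for the minimum. *)
  have Wm : W (2^-1 *: (u n + u m)) by apply/WZ/WD.
  have := umin n _ Wm; have := umin m _ Wm.
  have -> : v - 2^-1 *: (u n + u m) = 2^-1 *: ((v - u n) + (v - u m)).
    have two : (2 : R[i]) != 0 by rewrite pnatr_eq0.
    apply: (scalerI two); rewrite scalerBr !scalerA divff// !scale1r scaler_nat.
    by rewrite mulr2n opprD addrACA.
  have -> : q (2^-1 *: (v - u n + (v - u m))) = 4^-1 * q (v - u n + (v - u m)).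
    apply: (@complexI R); rewrite rmorphM /= !qE normrZ exprMn; congr (_ * _).
    by rewrite fmorphV/= rmorph_nat normfV normr_nat; field.
  have : q (v - u n + (v - u m)) + q (u n - u m) = 2 * q (v - u n) + 2 * q (v - u m).
    have -> : q (u n - u m) = q (v - u n - (v - u m)).
      apply: (@complexI R); rewrite !qE -normrN; congr (`|_| ^+ 2).
      by rewrite !opprB [RHS]addrC addrA subrK.
    apply: (@complexI R); rewrite !rmorphD/= !rmorphM /= !rmorph_nat !qE.
    exact: parallelogram.
  move: (n.+1%:R^-1) (m.+1%:R^-1) => i1 i2 h1 h2 h3; lra.
have [l lP] : exists l, forall e : R[i], 0 < e ->
    exists N, forall n, (N <= n)%N -> `|l - u n| < e.
  apply: cauchy_seq_cvg => e e0.
  have e24 : 0 < e ^+ 2 / 4 by rewrite divr_gt0// exprn_gt0.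
  have [N NP] := complex_arch e24; exists N => k Nk.
  rewrite -(@ltr_pXn2r _ 2) ?nnegrE ?(ltW e0)// -qE.
  apply: (@le_lt_trans _ _ (2 * N.+1%:R^-1 + 2 * k.+1%:R^-1)).
    by have := qm N k; rewrite -lecR rmorphD !rmorphM !fmorphV !rmorph_nat.
  have h1 := NP _ (leqnn _); have h2 := NP _ Nk.
  have -> : e ^+ 2 = 2 * (e ^+ 2 / 4) + 2 * (e ^+ 2 / 4) by field.
  by rewrite ltrD// ltr_pM2l.
exists l; split.
  by move=> e /lP[N NP]; exists (u N) => //; exact: NP.
apply: orthogonal_of_minimal_norm WZ _ => w Ww.
(* For large n, each of the replacements of l by u n, of u n by u n + w and of
   u n by l costs at most e. *)
apply: (@le_eps _ _ _ 3); rewrite ?normr_real//.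
move=> e e0; have [N1 h1] := lP _ e0.
have [N2 h2] := complex_arch (exprn_gt0 2 e0).
pose n := maxn N1 N2.
have {h1} h1 := h1 n (leq_maxl _ _); have {h2} h2 := h2 n (leq_maxr _ _).
have h3 : `|v - u n| <= `|v - u n - w| + e.
  apply: ler_add_of_sqr => //; first exact: ltW.
  have := umin n (u n + w) (WD _ _ (Wu n) Ww).
  rewrite opprD addrA -lecR rmorphD /= !qE fmorphV/= rmorph_nat => /le_trans; apply.
  by rewrite lerD2l ltW.
have h4 : `|v - l| <= `|v - u n| + e.
  rewrite -(subrK (u n) v) -addrA (le_trans (ler_normD _ _))//.
  by rewrite subrK lerD2l -opprB normrN ltW.
have h5 : `|v - u n - w| <= `|v - l - w| + e.
  have -> : v - u n - w = (v - l - w) + (l - u n).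
    by rewrite [RHS]addrAC [v - l + _]addrA subrK.
  by rewrite (le_trans (ler_normD _ _))// lerD2l ltW.
rewrite (le_trans h4)// (le_trans (lerD h3 (lexx e)))//.
rewrite (le_trans (lerD (lerD h5 (lexx e)) (lexx e)))//.
by rewrite -!addrA lerD2l le_eqVlt; apply/orP; left; apply/eqP; ring.
Qed.

(** The number r = |f|^2 is in the approximate spectrum of A = f^* f: if |x| = 1
    and |f x|^2 is close to r, then
    |r x - A x|^2 = r^2 - 2 r |f x|^2 + |A x|^2 <= 2 r (r - |f x|^2)
    is small. *)
Lemma adjoint_mul_not_bounded_below {H K : hilbertType R} (f : {bounded H -> K}) x0 :
  f x0 != 0 -> exists2 r : R[i], 0 < r &
    forall C, 0 <= C -> exists x, C * `|r *: x - adjoint f (f x)| < `|x|.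
Proof.
move=> fx0.
have [C C0 fC] := bounded_le f.
have [p pE] := real_sqr_norm K.
have fZ a x : f (a *: x) = a *: f x by exact: linearZ_LR.
have f0 : f 0 = 0 by exact: linear0.
have nx0 : `|x0| != 0.
  by rewrite normr_eq0; apply: contraNneq fx0 => ->; rewrite f0.
pose e0 := `|x0|^-1 *: x0.
have unit (x : H) : `|x| != 0 -> `| `|x|^-1 *: x| = 1.
  by move=> nx; rewrite normrZ normfV normr_id mulVf.
pose D := [set p (f x) | x in [set x : H | `|x| = 1]].
have DS : has_sup D.
  split; first by exists (p (f e0)), e0 => //; exact: unit.
  exists (complex.Re C ^+ 2) => _ [x x1 <-].
  rewrite -lecR pE rmorphXn/= RRe_real ?ger0_real ?(ltW C0)//.
  by rewrite lerXn2r ?nnegrE ?(ltW C0)// -[leRHS]mulr1 -x1.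
pose s := sup D.
have Dle x : `|x| = 1 -> p (f x) <= s.
  by move=> x1; apply: sup_upper_bound => //; exists x.
have s0 : 0 < s.
  apply: lt_le_trans (Dle _ (unit _ nx0)).
  by rewrite -ltcR pE exprn_gt0// normr_gt0 fZ scaler_eq0 invr_eq0 negb_or nx0.
have fs x : `|f x| ^+ 2 <= s%:C * `|x| ^+ 2.
  have [x00|nx] := eqVneq `|x| 0.
    by move/eqP: (x00); rewrite normr_eq0 => /eqP ->; rewrite f0 !normr0 expr0n mulr0.
  have := Dle _ (unit _ nx); rewrite -lecR pE fZ normrZ normfV normr_id exprMn.
  by rewrite exprVn mulrC ler_pdivrMr// exprn_gt0// lt_neqAle eq_sym nx /=.
exists s%:C; first by rewrite ltcR.
move=> M M0.
pose A x := adjoint f (f x).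
have Af x y : inner (A x) y = inner (f x) (f y).
  by rewrite innerC -adjointP -innerC.
have As x : `|x| = 1 -> `|A x| ^+ 2 <= (s ^+ 2)%:C.
  move=> x1; have [A0|An] := eqVneq `|A x| 0.
    by rewrite A0 expr0n lecR sqr_ge0.
  have An2 : 0 < `|A x| ^+ 2 by rewrite exprn_gt0// lt_neqAle eq_sym An /=.
  (* |A x|^2 = <f x, f (A x)>, to which Cauchy-Schwarz applies. *)
  have h : (`|A x| ^+ 2) ^+ 2 <= (`|f x| * `|f (A x)|) ^+ 2.
    rewrite lerXn2r ?nnegrE ?mulr_ge0 ?exprn_ge0//.
    rewrite -innerE Af -[leLHS]ger0_norm ?inner_CS//.
    by rewrite -Af innerE exprn_ge0.
  rewrite -(ler_pM2r An2) -expr2 (le_trans h)//.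
  have -> : (s ^+ 2)%:C * `|A x| ^+ 2 = s%:C * (s%:C * `|A x| ^+ 2).
    by rewrite rmorphXn /= mulrA expr2.
  rewrite exprMn; apply: ler_pM; rewrite ?exprn_ge0//.
  by rewrite (le_trans (fs x))// x1 expr1n mulr1.
(* The real number m is at least M^2 and is nonzero even when M = 0. *)
have M20 : 0 < M ^+ 2 + 1 by rewrite ltr_wpDl// exprn_ge0.
pose m := complex.Re (M ^+ 2 + 1).
have mE : m%:C = M ^+ 2 + 1 by rewrite RRe_real// gtr0_real.
have m0 : 0 < m by rewrite -ltcR mE.
have eps0 : 0 < (m * (2 * s))^-1 by rewrite invr_gt0 !mulr_gt0.
have [_ [x x1 <-] xs] := sup_adherent eps0 DS.
exists x; rewrite -(@ltr_pXn2r _ 2) ?nnegrE ?mulr_ge0// exprMn x1 expr1n.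
have E : `|s%:C *: x - A x| ^+ 2 <= (2 * s * (s - p (f x)))%:C.
  have conjR (a : R) : (a%:C)^* = a%:C :> R[i] by exact: conjc_real.
  have Axx : inner (A x) x = (p (f x))%:C by rewrite Af innerE -pE.
  have xAx : inner x (A x) = (p (f x))%:C by rewrite innerC Axx conjR.
  rewrite -innerE innerBl !innerBr !innerZl !innerZr Axx xAx !innerE x1.
  rewrite expr1n mulr1 conjR.
  have := As x x1; rewrite expr2 !rmorphM/= rmorphB/= rmorph_nat.
  rewrite -subr_ge0 => h; rewrite -subr_ge0.
  by apply: le_trans h _; rewrite le_eqVlt; apply/orP; left; apply/eqP; ring.
have E0 : 0 <= (s - p (f x))%:C by rewrite lecR subr_ge0 Dle.
apply: (@le_lt_trans _ _ ((m * (2 * s * (s - p (f x))))%:C)).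
  rewrite rmorphM/= mE ler_pM ?exprn_ge0//.
  by rewrite lerDl.
rewrite ltcR mulrA mulrC -ltr_pdivlMr; last by rewrite !mulr_gt0.
by rewrite mul1r ltrBlDr -ltrBlDl.
Qed.

Lemma eq0_of_orthogonal_approx {H : hilbertType R} (W : set H) (z : H) :
  (forall e : R[i], 0 < e -> exists2 w, W w & `|z - w| < e) ->
  (forall w, W w -> inner w z = 0) -> z = 0.
Proof.
move=> zW Wz; apply/eqP; rewrite -normr_eq0 -sqrf_eq0 -innerE -normr_le0.
apply: (@le_eps _ _ _ `|z|); rewrite ?normr_real//.
move=> e /zW[w Ww zw]; rewrite add0r -[X in inner X z](subrK w) innerDl.
by rewrite (Wz w)// addr0 (le_trans (inner_CS _ _))// mulrC ler_wpM2l// ltW.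
Qed.

(** The kernel of the adjoint of f is the orthogonal complement of the range
    of f. *)
Lemma dense_range_adjoint {H K : hilbertType R} (f : {bounded H -> K}) :
  dense (range f) <-> injective (adjoint f).
Proof.
split=> [df x y fxy|finj O [v Ov] oO].
  apply/eqP; rewrite -subr_eq0; apply/eqP.
  apply: (eq0_of_orthogonal_approx (range f)) => [e e0|_ [t _ <-]].
    have [|w []] := df (ball (x - y) e) _ (ball_open _ _).
      by exists (x - y); exact: ballxx.
    by rewrite -ball_normE/= => h fw; exists w.
  by rewrite adjointP linearB /= fxy subrr linear0r.
have [||l [lW lort]] := orthogonal_projection (range f) v.
- by exists 0 => //; exact: linear0.
- by move=> a _ _ [x _ <-] [y _ <-]; exists (a *: x + y) => //; exact: linearP.
have vl : v = l.
  apply/eqP; rewrite -subr_eq0; apply/eqP; apply: finj.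
  rewrite [RHS]linear0; apply: inner_inj => t.
  by rewrite -adjointP innerC lort ?rmorph0 ?linear0r//; exists t.
have /nbhs_ballP[e /= e0 eO] : nbhs v O by apply: open_nbhs_nbhs; split.
have [w Ww lw] := lW _ e0; exists w; split => //.
by apply: eO; rewrite -ball_normE/= vl.
Qed.

(** This is the identity <f f^* d, d> = |f^* d|^2. *)
Lemma injective_comp_adjoint {H K : hilbertType R} (f : {bounded H -> K}) :
  injective (adjoint f) -> injective (f \o adjoint f).
Proof.
move=> finj x y /= fxy; apply: finj.
have fd : f (adjoint f (x - y)) = 0 by rewrite !linearB /= fxy subrr.
apply/eqP; rewrite -subr_eq0 -linearB -normr_eq0 -sqrf_eq0 -innerE.
by rewrite -adjointP fd linear0l.
Qed.

End Hilbert.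

(** * Maximal modular ideals of a Hilbertian algebra *)

Section FrobeniusAlgebra.
Local Open Scope classical_set_scope.
Local Open Scope complex_scope.
Local Open Scope ring_scope.

Context {R : realType} {H : hilbertType R} {HH : hilbertTensor H H}.
Variable mu : {bounded HH -> H}.
Hypothesis mu_alg : hilbertian_algebra mu.

Local Notation "x ∙ y" := (hmul mu x y) (at level 40, left associativity).
Local Notation adjM y := (adjoint (regular_rep mu y)).

Let mulA : associative (hmul mu) := proj1 mu_alg.
Let mulC : commutative (hmul mu) := proj2 mu_alg.

Let mul_addr x y z : x ∙ (y + z) = x ∙ y + x ∙ z.
Proof. exact: linearD. Qed.
Let mul_subr x y z : x ∙ (y - z) = x ∙ y - x ∙ z.
Proof. exact: linearB. Qed.
Let mul_scaler (a : R[i]) x y : x ∙ (a *: y) = a *: (x ∙ y).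
Proof. exact: linearZ_LR. Qed.
Let mul_subl x y z : (x - y) ∙ z = x ∙ z - y ∙ z.
Proof. by rewrite mulC mul_subr !(mulC z). Qed.
Let mul_scalel (a : R[i]) x y : (a *: x) ∙ y = a *: (x ∙ y).
Proof. by rewrite mulC mul_scaler (mulC y). Qed.

Lemma adjoint_regular_rep y a b : inner (y ∙ a) b = inner a (adjM y b).
Proof. by rewrite -adjointP. Qed.

(** An ideal J that contains all the x - ex is proper exactly when it does not
    contain e, and this condition is preserved by unions of chains. *)
Lemma maximal_modular_extension (I : set H) e :
  algebra_ideal mu I -> (forall x, I (x - e ∙ x)) -> ~ I e ->
  exists J, [/\ maximal_modular_ideal mu J, I `<=` J & ~ J e].
Proof.
move=> Iid Ie nIe.
(* The empty set is admitted because it is the union of the empty chain. *)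
pose P (A : set H) := (A !=set0 -> algebra_ideal mu A /\ I `<=` A) /\ ~ A e.
have I0 : I 0 by case: Iid.
have [F FP Ftot|A [[AI nAe] Amax]] := @Zorn_bigcup _ P.
  split; last by move=> [X /FP[_ +] Xe]; exact.
  move=> [x [X FX Xx]].
  have FPid Y z : F Y -> Y z -> algebra_ideal mu Y.
    by move=> FY Yz; have [+ _] := FP _ FY; case; first by exists z.
  have [[]] := FP _ FX; first by exists x.
  move=> Xid IX _; split; last by move=> z /IX Xz; exists X.
  split; first by exists X => //; exact: IX.
  - move=> a y z [Y FY Yy] [Z FZ Zz].
    have [YZ|ZY] := Ftot _ _ FY FZ.
      by exists Z => //; case: (FPid _ _ FZ Zz) => _ + _; apply => //; exact: YZ.
    by exists Y => //; case: (FPid _ _ FY Yy) => _ + _; apply => //; exact: ZY.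
  - move=> y z [Z FZ Zz]; exists Z => //.
    by case: (FPid _ _ FZ Zz) => _ _; exact.
have [Aid IA] : algebra_ideal mu A /\ I `<=` A.
  apply: AI; apply/set0P/negP => /eqP A0.
  apply: (Amax I); last by split => // _; split.
  by rewrite A0; split => // /(_ _ I0).
exists A; split => //; split => //.
- by exists e => x; exact: IA.
- by move=> AT; apply: nAe; rewrite AT.
- move=> J Jid AJ JT; apply/seteqP; split => //.
  apply: contrapT => nJA; apply: (Amax J) => //; split.
    by move=> _; split => //; exact: subset_trans AJ.
  move=> Je; apply: JT; apply/seteqP; split => // x _.
  have [_ Jlin Jmul] := Jid.
  rewrite -(subrK (e ∙ x) x) -[x - _]scale1r; apply: Jlin.
    exact/AJ/IA.
  by rewrite mulC; exact: Jmul.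
Qed.

(** In the unitization, (1 - e) (1 + v) = 1.  If e is not of the form v - ev, the
    ideal of all v - ev extends to a maximal modular ideal which misses e. *)
Lemma jacobson_quasi_inverse e : jacobson_radical mu e ->
  exists v, v - e ∙ v = e.
Proof.
move=> Je; apply: contrapT => ne.
pose I := range (fun x => x - e ∙ x).
have [||[v _ ve]|J [Jmax _]] := @maximal_modular_extension I e.
- split.
  + by exists 0 => //; rewrite [_ ∙ _]linear0 subr0.
  + move=> a _ _ [x _ <-] [y _ <-]; exists (a *: x + y) => //.
    by rewrite mul_addr mul_scaler opprD addrACA scalerBr.
  + move=> x _ [y _ <-]; exists (x ∙ y) => //.
    by rewrite mul_subr !mulA (mulC e).
- by move=> x; exists x.
- by apply: ne; exists v.
- by apply; exact: Je.
Qed.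

Lemma jacobson_scale (a : R[i]) u :
  jacobson_radical mu u -> jacobson_radical mu (a *: u).
Proof.
move=> Ju I Imax; have Iu := Ju I Imax.
by case: Imax => -[I0 Ilin _] _ _ _; rewrite -[_ *: _]addr0; exact: Ilin.
Qed.

(** If e is a unit modulo a modular ideal I and eu = 0, then u = u - eu is
    in I. *)
Lemma semisimple_faithful : semisimple mu -> faithful mu.
Proof.
move=> ss; apply/seteqP; split => u /=; last first.
  by move=> -> x; rewrite /= mulC [LHS]linear0.
move=> uann; rewrite -[_ = _]/([set 0] u) -ss => I [[I0 Ilin Imul] [e Ie] _ _].
have := Ie u; rewrite mulC.
by have /= -> := uann e; rewrite subr0.
Qed.

(** * Consequences of the Frobenius equation *)

Variables (HH_H : hilbertTensor HH H) (H_HH : hilbertTensor H HH).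
Hypothesis mu_frob : frobenius mu HH_H H_HH.

(** By the Frobenius equation, mu^dagger (ab) is mu^dagger b with its first
    tensor factor multiplied by a, while M_y^* is mu^dagger followed by the
    slice map S : p (x) q |-> <q, y> p, which only sees the second factor. *)
Lemma adjoint_regular_rep_multiplier y a b : adjM y (a ∙ b) = a ∙ adjM y b.
Proof.
have [tr trE] : exists h : {bounded H -> HH}, forall z, h z = tensor HH z y.
  have [|z|h hE] := @ex_bounded _ _ _ (fun z => tensor HH z y) `|y| _ (normr_ge0 _).
  - by move=> c z z'; rewrite linearDl linearZl_LR.
  - by rewrite norm_tensor mulrC.
  - by exists h => z; rewrite hE.
have [ta taE] : exists h : {bounded HH -> H_HH}, forall t, h t = tensor H_HH a t.
  have [|z|h hE] := @ex_bounded _ _ _ (fun t => tensor H_HH a t) `|a| _ (normr_ge0 _).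
  - by move=> c z z'; rewrite linearDr linearZr_LR.
  - by rewrite norm_tensor.
  - by exists h => z; rewrite hE.
(* S is the adjoint of z |-> z (x) y. *)
pose S := adjoint tr.
have SE p q : S (tensor HH p q) = inner q y *: p.
  apply: inner_inj => x; rewrite -adjointP trE inner_tensor innerZr.
  by rewrite mulrC -innerC.
have adjME z : adjM y z = S (adjoint mu z).
  by apply: inner_inj => x; rewrite -adjoint_regular_rep -!adjointP trE mulC.
pose idH : {bounded H -> H} := idfun.
pose f : {bounded HH -> H} := S \o (tensor_map HH_H HH mu idH
  \o tensor_assocV HH_H H_HH \o ta).
pose g : {bounded HH -> H} := regular_rep mu a \o S.
have fg : f =1 g.
  apply: (eq_total_family (@total_tensor _ _ _ HH)) => -[p q] /=.
  rewrite /f /g /= taE tensor_assocVE tensor_mapE !SE.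
  by rewrite [RHS]mul_scaler.
have muab : adjoint mu (a ∙ b) =
    tensor_map HH_H HH mu idH (tensor_assocV HH_H H_HH (ta (adjoint mu b))).
  have [/(_ (tensor HH a b : HH)) /= <- _] := mu_frob.
  by rewrite tensor_mapE taE.
by rewrite !adjME muab; exact: fg.
Qed.

(** Multiplication operators are normal: both squared norms are equal to
    <u, x M_x^* u>. *)
Lemma norm_regular_rep_adjoint x u : `|x ∙ u| = `|adjM x u|.
Proof.
apply/eqP; rewrite -(@eqrXn2 _ 2)// -!innerE adjoint_regular_rep.
rewrite adjoint_regular_rep_multiplier.
by rewrite [X in X == _]innerC adjoint_regular_rep -innerC.
Qed.

(** If u is an annihilator, then <ab, u> = <b, M_a^* u> = 0 by normality.
    Conversely, |xu|^2 = <u, M_x^* (xu)> = <u, x M_x^* u>, where u is paired with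
    a product. *)
Lemma annihilator_ker_adjoint u :
  (forall x, u ∙ x = 0) <-> adjoint mu u = 0.
Proof.
split=> [uann|mu0 x].
  pose W : set HH := [set \sum_(p <- s) tensor HH p.1 p.2 | s in [set: seq (H * H)]].
  apply: (eq0_of_orthogonal_approx W).
    move=> e e0; have [|w []] := @dense_tensor _ _ _ HH (ball (adjoint mu u) e) _
        (ball_open _ _).
      by exists (adjoint mu u); exact: ballxx.
    by rewrite -ball_normE/= => h fw; exists w.
  move=> _ [s _ <-]; rewrite inner_suml big1// => p _.
  rewrite -adjointP -[mu _]/(p.1 ∙ p.2) adjoint_regular_rep.
  suff -> : adjM p.1 u = 0 by rewrite linear0r.
  by apply/eqP; rewrite -normr_eq0 -norm_regular_rep_adjoint mulC uann normr0.
apply/eqP; rewrite mulC -normr_eq0 -sqrf_eq0 -innerE adjoint_regular_rep.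
rewrite adjoint_regular_rep_multiplier innerC.
have -> z w : inner (z ∙ w) u = 0 by rewrite /hmul adjointP mu0 linear0r.
by rewrite rmorph0.
Qed.

Lemma faithful_injective_adjoint : faithful mu <-> injective (adjoint mu).
Proof.
split=> [fm x y xy|inj].
  apply/eqP; rewrite -subr_eq0; apply/eqP.
  rewrite -[_ = _]/([set 0] (x - y)) -fm => z /=.
  have /annihilator_ker_adjoint : adjoint mu (x - y) = 0.
    by rewrite linearB /= xy subrr.
  exact.
apply/seteqP; split => u /=; last by move=> -> x; rewrite /= mulC [LHS]linear0.
move=> /annihilator_ker_adjoint u0; apply: inj; rewrite u0.
by rewrite linear0.
Qed.

(** Every multiplier m preserves a maximal modular ideal I containing u: if e is
    a unit modulo I, then m u is congruent to e (m u) = (m e) u. *)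
Lemma jacobson_adjoint_regular_rep y u :
  jacobson_radical mu u -> jacobson_radical mu (adjM y u).
Proof.
move=> Ju I Imax; have Iu := Ju I Imax.
case: Imax => -[I0 Ilin Imul] [e Ie] _ _.
rewrite -(subrK (e ∙ adjM y u) (adjM y u)) -[X in X + _]scale1r.
apply: Ilin; first exact: Ie.
rewrite -adjoint_regular_rep_multiplier mulC adjoint_regular_rep_multiplier mulC.
exact: Imul.
Qed.

(** If M_u were nonzero for some u in the radical, then e = M_u^* u / r, with
    r = |M_u|^2, would have a quasi-inverse v, and 1 + M_v would bound the inverse
    of 1 - M_e = (r - M_u^* M_u) / r, although r is in the approximate spectrum
    of M_u^* M_u. *)
Lemma faithful_semisimple : faithful mu -> semisimple mu.
Proof.
move=> fm; apply/seteqP; split => u /=; last first.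
  by move=> -> I [[I0 _ _] _ _ _].
move=> Ju; rewrite -[_ = _]/([set 0] u) -fm => x0 /=.
apply: contrapT => /eqP ux0.
have [r r0 rP] := @adjoint_mul_not_bounded_below _ _ _ (regular_rep mu u) x0 ux0.
pose e := r^-1 *: adjM u u.
have [v ve] : exists v, v - e ∙ v = e.
  apply: jacobson_quasi_inverse; apply: jacobson_scale.
  exact: jacobson_adjoint_regular_rep.
pose Ax x := adjM u (u ∙ x).
have AxE x : r^-1 *: (r *: x - Ax x) = x - e ∙ x.
  rewrite scalerBr scalerA mulVf ?gt_eqF// scale1r /Ax mulC.
  by rewrite adjoint_regular_rep_multiplier mul_scalel mulC.
have xE x : x = (x - e ∙ x) + v ∙ (x - e ∙ x).
  by rewrite mul_subr mulA (mulC v e) -mul_subl ve subrK.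
have [C C0 vC] := bounded_le (regular_rep mu v).
have rV0 : 0 <= r^-1 by rewrite invr_ge0 ltW.
have [|x] := rP (r^-1 * (1 + C)).
  by rewrite mulr_ge0// addr_ge0// ltW.
move=> /lt_le_trans h; suff /h : `|x| <= r^-1 * (1 + C) * `|r *: x - Ax x|.
  by rewrite ltxx.
rewrite {1}(xE x) (le_trans (ler_normD _ _))//.
rewrite (le_trans (lerD (lexx _) (vC _)))//.
by rewrite -AxE normrZ ger0_norm// mulrAC mulrDr mulr1 [X in _ <= _ + X]mulrC.
Qed.

End FrobeniusAlgebra.

Theorem theorem33 (R : realType) (H : hilbertType R)
    (HH : hilbertTensor H H)
    (HH_H : hilbertTensor HH H) (H_HH : hilbertTensor H HH)
    (mu : {bounded HH -> H}) :
  hilbertian_frobenius_semigroup HH_H H_HH mu ->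
  [<-> semisimple mu;
       faithful mu;
       dense (range mu);
       injective (adjoint mu);
       injective (mu \o adjoint mu)]
  /\ (special mu -> semisimple mu).
Proof.
move=> [mu_alg mu_frob].
have injective_semisimple : injective (mu \o adjoint mu) -> semisimple mu.
  move=> inj; apply: (faithful_semisimple mu mu_alg _ _ mu_frob).
  apply/(faithful_injective_adjoint mu mu_alg _ _ mu_frob) => x y xy.
  by apply: inj; rewrite /= xy.
split; last by move=> sp; apply: injective_semisimple => x y; rewrite !sp.
tfae.
- exact: (semisimple_faithful mu mu_alg).
- move=> fm; apply/dense_range_adjoint.
  exact/(faithful_injective_adjoint mu mu_alg _ _ mu_frob).
- by move/dense_range_adjoint.
- exact: injective_comp_adjoint.
- exact: injective_semisimple.
Qed.
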